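(* Let $n$ be a positive integer. The group $GH_n$ admits a presentation with generators $y_{k,l}$ for $1\le k<l\le n$ and defining relations $$y_{k,l}^2=1,$$ $$(y_{i,j}\,y_{k,l})^2=1,$$ $$(y_{i,k}\,y_{k,j})^3=(y_{i,j}\,y_{k,j})^3=(y_{i,k}\,y_{i,j})^3=1,$$ where distinct letters stand for distinct indices (each relation being imposed for all choices of indices for which the generators occurring in it have their first index smaller than their second one).
   Context: The virtual braid group $VB_n$ is the group with generators $\sigma_1,\dots,\sigma_{n-1},\rho_1,\dots,\rho_{n-1}$ and defining relations: (R1) $\sigma_i\sigma_{i+1}\sigma_i=\sigma_{i+1}\sigma_i\sigma_{i+1}$ for $1\le i\le n-2$; (R2) $\sigma_i\sigma_j=\sigma_j\sigma_i$ for $|i-j|\ge 2$; (R3) $\rho_i\rho_{i+1}\rho_i=\rho_{i+1}\rho_i\rho_{i+1}$ for $1\le i\le n-2$; (R4) $\rho_i\rho_j=\rho_j\rho_i$ for $|i-j|\ge 2$; (R5) $\rho_i^2=1$ for $1\le i\le n-1$; (R6) $\sigma_i\rho_j=\rho_j\sigma_i$ for $|i-j|\ge 2$; (M) $\rho_i\rho_{i+1}\sigma_i=\sigma_{i+1}\rho_i\rho_{i+1}$ for $1\le i\le n-2$. The flat virtual braid group $FVB_n$ is the quotient of $VB_n$ by the relations $\sigma_i^2=1$ for $1\le i\le n-1$; the image of $\sigma_i$ is denoted $s_i$ and the image of $\rho_i$ is still denoted $\rho_i$. The virtual Gauss braid group $GVB_n$ is the quotient of $FVB_n$ by the relations $s_i\rho_i=\rho_is_i$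 for $1\le i\le n-1$. $GH_n$ is the kernel of the homomorphism $\mu\colon GVB_n\to S_n$ given by $\mu(s_i)=1$, $\mu(\rho_i)=(i,i+1)$ for $1\le i\le n-1$. The elements $y_{k,l}\in GH_n$, $k<l$, are defined by $y_{i,i+1}=s_i$ for $1\le i\le n-1$ and $y_{i,j}=\rho_{j-1}\cdots\rho_{i+1}\,s_i\,\rho_{i+1}\cdots\rho_{j-1}$ for $1\le i<j-1\le n-1$ (as elements of $GVB_n$). *)

(* Defs.v *)
From HB Require Import structures.
From mathcomp Require Import all_boot all_fingroup.
From mathcomp Require Import boolp zify.

Set Implicit Arguments.
Unset Strict Implicit.
Unset Printing Implicit Defensive.

(* fingroup exports another repr. *)
Local Notation qrepr := generic_quotient.repr.

Local Open Scope quotient_scope.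
Local Open Scope group_scope.

Notation groupMorphism := UMagmaMorphism.type.

Lemma group_morphism (G H : groupType) (f : G -> H) :
  {morph f : x y / x * y} -> monoid_morphism f.
Proof. by move=> fM; split=> //; apply: (mulgI (f 1)); rewrite -fM !mulg1. Qed.

(* In a word, (x, true) stands for x and (x, false) for its inverse. *)

Section FreeGroup.
Variable X : choiceType.
Implicit Types u v w : seq (X * bool).

Inductive word_eqv : seq (X * bool) -> seq (X * bool) -> Prop :=
| word_eqv_cancel u v x e :
    word_eqv (u ++ (x, e) :: (x, ~~ e) :: v) (u ++ v)
| word_eqv_refl u : word_eqv u u
| word_eqv_sym u v : word_eqv u v -> word_eqv v u
| word_eqv_trans u v w : word_eqv u v -> word_eqv v w -> word_eqv u w.

Definition word_eqb u v : bool := `[< word_eqv u v >].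

Fact word_eqb_equiv : equiv_class_of word_eqb.
Proof.
split=> [u | u v | v u w].
- exact/asboolP/word_eqv_refl.
- by apply: asbool_equiv_eq; split; apply: word_eqv_sym.
- by move=> /asboolP uv /asboolP vw; apply/asboolP/(word_eqv_trans uv).
Qed.

Canonical word_equiv := EquivRelPack word_eqb_equiv.

Definition freeGroup := {eq_quot word_eqb}.

HB.instance Definition _ := Choice.on freeGroup.
HB.instance Definition _ := EqQuotient.on freeGroup.

Definition free_pi (w : seq (X * bool)) : freeGroup := \pi_freeGroup w.

Definition word_inv (w : seq (X * bool)) := rev [seq (a.1, ~~ a.2) | a <- w].

Definition free_one : freeGroup := free_pi [::].
Definition free_mul (a b : freeGroup) : freeGroup :=
  free_pi (qrepr a ++ qrepr b).
Definition free_inv (a : freeGroup) : freeGroup := free_pi (word_inv (qrepr a)).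

Definition free_gen (x : X) : freeGroup := free_pi [:: (x, true)].

Lemma free_piP u v : free_pi u = free_pi v <-> word_eqv u v.
Proof.
split=> [/eqmodP/asboolP // | uv]; exact/eqmodP/asboolP.
Qed.

Lemma free_reprK (a : freeGroup) : free_pi (qrepr a) = a.
Proof. exact: reprK. Qed.

Lemma word_eqv_cat u u' v v' :
  word_eqv u u' -> word_eqv v v' -> word_eqv (u ++ v) (u' ++ v').
Proof.
move=> uu' vv'; apply: (@word_eqv_trans _ (u' ++ v)).
- elim: uu' => {u u'} [a b x e | u | u w _ | u w t _ uw _ wt].
  + by rewrite -!catA /=; apply: word_eqv_cancel.
  + exact: word_eqv_refl.
  + exact: word_eqv_sym.
  + exact: word_eqv_trans uw wt.
- elim: vv' => {v v'} [a b x e | v | v w _ | v w t _ vw _ wt].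
  + by rewrite !catA; apply: word_eqv_cancel.
  + exact: word_eqv_refl.
  + exact: word_eqv_sym.
  + exact: word_eqv_trans vw wt.
Qed.

Lemma word_eqv_inv u v : word_eqv u v -> word_eqv (word_inv u) (word_inv v).
Proof.
elim=> {u v} [u v x e | u | u v _ | u v w _ uv _ vw].
- rewrite /word_inv !map_cat !rev_cat /= !rev_cons -!cats1 -!catA /=.
  rewrite negbK; exact: word_eqv_cancel.
- exact: word_eqv_refl.
- exact: word_eqv_sym.
- exact: word_eqv_trans uv vw.
Qed.

Lemma word_eqv_invl u : word_eqv (word_inv u ++ u) [::].
Proof.
elim: u => [|[x e] u IHu]; first exact: word_eqv_refl.
rewrite /word_inv /= rev_cons -cats1 -catA /=.
apply: word_eqv_trans IHu; rewrite -{2}[e]negbK; exact: word_eqv_cancel.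
Qed.

Lemma word_invK u : word_inv (word_inv u) = u.
Proof.
rewrite /word_inv map_rev revK -map_comp -[RHS]map_id.
by apply: eq_map => -[x e] /=; rewrite negbK.
Qed.

Lemma free_mul_pi u v : free_mul (free_pi u) (free_pi v) = free_pi (u ++ v).
Proof. by apply/free_piP/word_eqv_cat; apply/free_piP; rewrite free_reprK. Qed.

Lemma free_inv_pi u : free_inv (free_pi u) = free_pi (word_inv u).
Proof. by apply/free_piP/word_eqv_inv/free_piP; rewrite free_reprK. Qed.

Fact free_mulA : associative free_mul.
Proof.
move=> a b c; rewrite -[a]free_reprK -[b]free_reprK -[c]free_reprK.
by rewrite !free_mul_pi catA.
Qed.

Fact free_mul1g : left_id free_one free_mul.
Proof. by move=> a; rewrite -[a]free_reprK free_mul_pi. Qed.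

Fact free_mulg1 : right_id free_one free_mul.
Proof. by move=> a; rewrite -[a]free_reprK free_mul_pi cats0. Qed.

Fact free_mulVg : left_inverse free_one free_inv free_mul.
Proof.
move=> a; rewrite -[a]free_reprK free_inv_pi free_mul_pi.
exact/free_piP/word_eqv_invl.
Qed.

Fact free_mulgV : right_inverse free_one free_inv free_mul.
Proof.
move=> a; rewrite -[a]free_reprK free_inv_pi free_mul_pi.
by rewrite -{1}[qrepr a]word_invK; apply/free_piP/word_eqv_invl.
Qed.

HB.instance Definition _ := isGroup.Build freeGroup
  free_mulA free_mul1g free_mulg1 free_mulVg free_mulgV.

End FreeGroup.

Section FreeLift.
Variables (X : choiceType) (G : groupType) (f : X -> G).

Definition word_eval (w : seq (X * bool)) : G :=
  \prod_(a <- w) (if a.2 then f a.1 else (f a.1)^-1).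

Definition free_lift (a : freeGroup X) : G := word_eval (qrepr a).

Lemma word_eval_eqv u v : word_eqv u v -> word_eval u = word_eval v.
Proof.
elim=> {u v} [u v x e | // | // | u v w _ -> //].
rewrite /word_eval !big_cat /= !big_cons /=; congr (_ * _).
by case: e => /=; rewrite mulgA ?mulgV ?mulVg mul1g.
Qed.

Lemma free_lift_pi w : free_lift (free_pi w) = word_eval w.
Proof. by apply/word_eval_eqv/free_piP; rewrite free_reprK. Qed.

Fact free_lift_is_multiplicative : {morph free_lift : a b / a * b}.
Proof.
move=> a b; rewrite -[a]free_reprK -[b]free_reprK.
by rewrite [_ * _]free_mul_pi !free_lift_pi /word_eval big_cat.
Qed.

HB.instance Definition _ := isUMagmaMorphism.Build (freeGroup X) G free_lift
  (group_morphism free_lift_is_multiplicative).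

Lemma free_lift_gen x : free_lift (free_gen x) = f x.
Proof. by rewrite free_lift_pi /word_eval big_seq1. Qed.

End FreeLift.

(* Imposing the relations a = b, for R a b, on a group G amounts to dividing  *)
(* G by the least congruence containing R; the class of 1 is then the normal  *)
(* closure of the elements a / b.                                             *)

Section GroupQuotient.
Variables (G : groupType) (R : G -> G -> Prop).
Implicit Types a b c d : G.

Inductive group_congr : G -> G -> Prop :=
| group_congr_rel a b : R a b -> group_congr a b
| group_congr_refl a : group_congr a a
| group_congr_sym a b : group_congr a b -> group_congr b a
| group_congr_trans a b c :
    group_congr a b -> group_congr b c -> group_congr a c
| group_congr_mul a b c d :
    group_congr a b -> group_congr c d -> group_congr (a * c) (b * d).

Definition group_congrb a b : bool := `[< group_congr a b >].

Fact group_congrb_equiv : equiv_class_of group_congrb.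
Proof.
split=> [a | a b | b a c].
- exact/asboolP/group_congr_refl.
- by apply: asbool_equiv_eq; split; apply: group_congr_sym.
- by move=> /asboolP ab /asboolP bc; apply/asboolP/(group_congr_trans ab).
Qed.

Canonical group_congr_equiv := EquivRelPack group_congrb_equiv.

Definition groupQuot := {eq_quot group_congrb}.

HB.instance Definition _ := Choice.on groupQuot.
HB.instance Definition _ := EqQuotient.on groupQuot.

Definition quot_pi a : groupQuot := \pi_groupQuot a.

Lemma quot_piP a b : quot_pi a = quot_pi b <-> group_congr a b.
Proof.
split=> [/eqmodP/asboolP // | ab]; exact/eqmodP/asboolP.
Qed.

Lemma quot_reprK (x : groupQuot) : quot_pi (qrepr x) = x.
Proof. exact: reprK. Qed.

Lemma group_congr_inv a b : group_congr a b -> group_congr a^-1 b^-1.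
Proof.
move=> ab; rewrite -[a^-1]mulg1 -[b^-1]mul1g -{1}(mulgV b) -(mulVg a) mulgA.
apply: group_congr_mul (group_congr_refl _).
apply: group_congr_mul (group_congr_refl _) _; exact: group_congr_sym.
Qed.

Definition quot_one : groupQuot := quot_pi 1.
Definition quot_mul (x y : groupQuot) : groupQuot :=
  quot_pi (qrepr x * qrepr y).
Definition quot_inv (x : groupQuot) : groupQuot := quot_pi (qrepr x)^-1.

Lemma quot_mul_pi a b : quot_mul (quot_pi a) (quot_pi b) = quot_pi (a * b).
Proof.
by apply/quot_piP/group_congr_mul; apply/quot_piP; rewrite quot_reprK.
Qed.

Lemma quot_inv_pi a : quot_inv (quot_pi a) = quot_pi a^-1.
Proof. by apply/quot_piP/group_congr_inv/quot_piP; rewrite quot_reprK. Qed.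

Fact quot_mulA : associative quot_mul.
Proof.
move=> x y z; rewrite -[x]quot_reprK -[y]quot_reprK -[z]quot_reprK.
by rewrite !quot_mul_pi mulgA.
Qed.

Fact quot_mul1g : left_id quot_one quot_mul.
Proof. by move=> x; rewrite -[x]quot_reprK quot_mul_pi mul1g. Qed.

Fact quot_mulg1 : right_id quot_one quot_mul.
Proof. by move=> x; rewrite -[x]quot_reprK quot_mul_pi mulg1. Qed.

Fact quot_mulVg : left_inverse quot_one quot_inv quot_mul.
Proof. by move=> x; rewrite -[x]quot_reprK quot_inv_pi quot_mul_pi mulVg. Qed.

Fact quot_mulgV : right_inverse quot_one quot_inv quot_mul.
Proof. by move=> x; rewrite -[x]quot_reprK quot_inv_pi quot_mul_pi mulgV. Qed.

HB.instance Definition _ := isGroup.Build groupQuot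
  quot_mulA quot_mul1g quot_mulg1 quot_mulVg quot_mulgV.

Fact quot_pi_is_multiplicative : {morph quot_pi : a b / a * b}.
Proof. by move=> a b; rewrite -quot_mul_pi. Qed.

HB.instance Definition _ := isUMagmaMorphism.Build G groupQuot quot_pi
  (group_morphism quot_pi_is_multiplicative).

Lemma quot_pi_rel a b : R a b -> quot_pi a = quot_pi b.
Proof. by move=> Rab; apply/quot_piP/group_congr_rel. Qed.

End GroupQuotient.

Section QuotLift.
Variables (G H : groupType) (R : G -> G -> Prop) (f : groupMorphism G H).
Hypothesis fR : forall a b, R a b -> f a = f b.

(* The proof argument lets quot_lift fR be inferred to be a morphism. *)
Definition quot_lift of (forall a b, R a b -> f a = f b) :=
  fun x : groupQuot R => f (qrepr x).

Lemma quot_lift_pi a : quot_lift fR (quot_pi R a) = f a.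
Proof.
suff congr_f b c : group_congr R b c -> f b = f c.
  by apply/congr_f/quot_piP; rewrite quot_reprK.
elim=> {b c} [b c /fR // | // | // | b c d _ -> // | b c d e _ bc _ de].
by rewrite !gmulfM bc de.
Qed.

Fact quot_lift_is_multiplicative : {morph quot_lift fR : x y / x * y}.
Proof.
move=> x y; rewrite -[x]quot_reprK -[y]quot_reprK.
by rewrite -gmulfM !quot_lift_pi gmulfM.
Qed.

HB.instance Definition _ := isUMagmaMorphism.Build (groupQuot R) H
  (quot_lift fR) (group_morphism quot_lift_is_multiplicative).

End QuotLift.

(* G admits the presentation with generators x a, for a in X, and defining    *)
(* relations R.                                                               *)
Definition is_presentation (X : choiceType)
    (R : freeGroup X -> freeGroup X -> Prop) (G : groupType) (x : X -> G) :=
  exists f : groupMorphism (groupQuot R) G,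
    bijective f /\ forall a, f (quot_pi R (free_gen a)) = x a.

Section Kernel.
Variables (G H : groupType) (f : groupMorphism G H).

Definition in_ker : pred G := fun a => f a == 1.

Definition kerGroup := {a : G | in_ker a}.

HB.instance Definition _ := SubChoice.on kerGroup.

Fact in_ker_group_closed : group_closed in_ker.
Proof.
split=> [|a b]; rewrite !unfold_in /in_ker ?gmulf1 //.
by move=> /eqP fa /eqP fb; rewrite gmulfF fa fb mulgV.
Qed.

HB.instance Definition _ := SubChoice_isSubGroup.Build G in_ker kerGroup
  in_ker_group_closed.

End Kernel.

(* Indices are shifted to start at 0: the generators sigma_i, rho_i are       *)
(* indexed by 0 <= i < n - 1, and S_n acts on {0, ..., n - 1}.                *)

Section VirtualBraids.
Variable n : nat.
Implicit Types i j : 'I_n.-1.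

Local Notation FV := (freeGroup ('I_n.-1 + 'I_n.-1)%type).
Definition free_sigma i : FV := free_gen (inl i).
Definition free_rho i : FV := free_gen (inr i).

Definition far i j : bool := (i.+1 < j) || (j.+1 < i).

Local Notation S := free_sigma.
Local Notation P := free_rho.

Inductive VB_rel : FV -> FV -> Prop :=
| VB_R1 i j : j = i.+1 :> nat -> VB_rel (S i * S j * S i) (S j * S i * S j)
| VB_R2 i j : far i j -> VB_rel (S i * S j) (S j * S i)
| VB_R3 i j : j = i.+1 :> nat -> VB_rel (P i * P j * P i) (P j * P i * P j)
| VB_R4 i j : far i j -> VB_rel (P i * P j) (P j * P i)
| VB_R5 i : VB_rel (P i ^+ 2) 1
| VB_R6 i j : far i j -> VB_rel (S i * P j) (P j * S i)
| VB_M i j : j = i.+1 :> nat -> VB_rel (P i * P j * S i) (S j * P i * P j).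

Definition VB := groupQuot VB_rel.
HB.instance Definition _ := Group.on VB.

Definition VB_sigma i : VB := quot_pi VB_rel (free_sigma i).
Definition VB_rho i : VB := quot_pi VB_rel (free_rho i).

Inductive FVB_rel : VB -> VB -> Prop :=
| FVB_sq i : FVB_rel (VB_sigma i ^+ 2) 1.

Definition FVB := groupQuot FVB_rel.
HB.instance Definition _ := Group.on FVB.

Definition FVB_s i : FVB := quot_pi FVB_rel (VB_sigma i).
Definition FVB_rho i : FVB := quot_pi FVB_rel (VB_rho i).

Inductive GVB_rel : FVB -> FVB -> Prop :=
| GVB_comm i : GVB_rel (FVB_s i * FVB_rho i) (FVB_rho i * FVB_s i).

Definition GVB := groupQuot GVB_rel.
HB.instance Definition _ := Group.on GVB.

Definition GVB_s i : GVB := quot_pi GVB_rel (FVB_s i).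
Definition GVB_rho i : GVB := quot_pi GVB_rel (FVB_rho i).

Fact pt_lo_proof i : i < n.
Proof. by rewrite (leq_trans (ltn_ord i)) ?leq_pred. Qed.
Fact pt_hi_proof i : i.+1 < n.
Proof. by rewrite -ltn_predRL. Qed.

Definition adj_tperm i : 'S_n :=
  tperm (Ordinal (pt_lo_proof i)) (Ordinal (pt_hi_proof i)).

Lemma adj_tperm_braid i j : j = i.+1 :> nat ->
  adj_tperm i * adj_tperm j * adj_tperm i =
  adj_tperm j * adj_tperm i * adj_tperm j.
Proof.
move=> ji; rewrite /adj_tperm.
set a := Ordinal (pt_lo_proof i); set b := Ordinal (pt_hi_proof i).
have -> : Ordinal (pt_lo_proof j) = b by apply: val_inj; rewrite /= ji.
set c := Ordinal (pt_hi_proof j).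
have ab : a != b by rewrite -val_eqE /= neq_ltn ltnSn.
have bc : b != c by rewrite -val_eqE /= ji neq_ltn ltnSn.
have ac : a != c by rewrite -val_eqE /= ji neq_ltn ltnS leqnSn.
have tconj (s t : 'S_n) : s * s = 1 -> s * t * s = t ^ s.
  move=> ss; suff sV : s^-1 = s by rewrite /conjg sV mulgA.
  by apply: (mulgI s); rewrite mulgV ss.
rewrite !tconj ?tperm2 // !tpermJ.
by rewrite tpermR tpermL tpermD ?[tperm b c a]tpermD // 1?eq_sym.
Qed.

Lemma adj_tperm_far i j : far i j ->
  adj_tperm i * adj_tperm j = adj_tperm j * adj_tperm i.
Proof.
move=> fij; apply/commgP/conjg_fixP; rewrite /adj_tperm tpermJ.
by congr tperm; rewrite tpermD // -val_eqE /=; apply/eqP=> e;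
  move: fij; rewrite /far e; lia.
Qed.

Definition mu_gen (x : 'I_n.-1 + 'I_n.-1) : 'S_n :=
  if x is inr i then adj_tperm i else 1.

Fact mu_VB_rel a b : VB_rel a b -> free_lift mu_gen a = free_lift mu_gen b.
Proof.
by case=> [i j ij|i j ij|i j ij|i j ij|i|i j ij|i j ij];
  rewrite /free_sigma /free_rho ?expg2 !gmulfM ?gmulf1 /=
          !free_lift_gen /= ?mulg1 ?mul1g
          ?tperm2 ?(adj_tperm_braid ij) ?(adj_tperm_far ij).
Qed.
Definition mu_VB : VB -> 'S_n := quot_lift mu_VB_rel.
HB.instance Definition _ := UMagmaMorphism.on mu_VB.

Lemma mu_VB_sigma i : mu_VB (VB_sigma i) = 1.
Proof. by rewrite [LHS](quot_lift_pi mu_VB_rel) /= free_lift_gen. Qed.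

Lemma mu_VB_rho i : mu_VB (VB_rho i) = adj_tperm i.
Proof. by rewrite [LHS](quot_lift_pi mu_VB_rel) /= free_lift_gen. Qed.

Fact mu_FVB_rel a b : FVB_rel a b -> mu_VB a = mu_VB b.
Proof. by case=> i; rewrite expg2 gmulfM gmulf1 /= mu_VB_sigma mulg1. Qed.
Definition mu_FVB : FVB -> 'S_n := quot_lift mu_FVB_rel.
HB.instance Definition _ := UMagmaMorphism.on mu_FVB.

Lemma mu_FVB_s i : mu_FVB (FVB_s i) = 1.
Proof. by rewrite [LHS](quot_lift_pi mu_FVB_rel) /= mu_VB_sigma. Qed.

Lemma mu_FVB_rho i : mu_FVB (FVB_rho i) = adj_tperm i.
Proof. by rewrite [LHS](quot_lift_pi mu_FVB_rel) /= mu_VB_rho. Qed.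

Fact mu_GVB_rel a b : GVB_rel a b -> mu_FVB a = mu_FVB b.
Proof. by case=> i; rewrite !gmulfM /= mu_FVB_s mulg1 mul1g. Qed.
Definition mu : GVB -> 'S_n := quot_lift mu_GVB_rel.
HB.instance Definition _ := UMagmaMorphism.on mu.

Lemma mu_s i : mu (GVB_s i) = 1.
Proof. by rewrite [LHS](quot_lift_pi mu_GVB_rel) /= mu_FVB_s. Qed.

Lemma mu_rho i : mu (GVB_rho i) = adj_tperm i.
Proof. by rewrite [LHS](quot_lift_pi mu_GVB_rel) /= mu_FVB_rho. Qed.

Definition GH := kerGroup mu.
HB.instance Definition _ := SubGroup.on GH.

(* s_m and rho_m for a natural number m, with junk value 1 for n - 1 <= m     *)
(* (never used below).                                                        *)
Definition s_ (m : nat) : GVB := oapp GVB_s 1 (insub m).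
Definition rho_ (m : nat) : GVB := oapp GVB_rho 1 (insub m).

(* rho_(j-1) ... rho_(i+1) s_i rho_(i+1) ... rho_(j-1), which is s_i when     *)
(* j = i + 1.                                                                 *)
Definition GVB_y (i j : nat) : GVB :=
  (\prod_(m <- rev (index_iota i.+1 j)) rho_ m) * s_ i *
  (\prod_(i.+1 <= m < j) rho_ m).

Lemma VB_rho_sq i : VB_rho i * VB_rho i = 1.
Proof. by rewrite -gmulfM /= -expg2 (quot_pi_rel (VB_R5 i)) gmulf1. Qed.

Lemma FVB_rho_sq i : FVB_rho i * FVB_rho i = 1.
Proof. by rewrite -gmulfM /= VB_rho_sq gmulf1. Qed.

Lemma GVB_rho_sq i : GVB_rho i * GVB_rho i = 1.
Proof. by rewrite -gmulfM /= FVB_rho_sq gmulf1. Qed.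

Lemma rho_sq m : rho_ m * rho_ m = 1.
Proof.
by rewrite /rho_; case: insubP => [k _ _|_] /=; rewrite ?GVB_rho_sq ?mulg1.
Qed.

Lemma mu_s_ m : mu (s_ m) = 1.
Proof. by rewrite /s_; case: insubP => [k _ _|_] /=; rewrite ?mu_s ?gmulf1. Qed.

Lemma prod_rho_rev (r : seq nat) :
  (\prod_(m <- rev r) rho_ m) * (\prod_(m <- r) rho_ m) = 1.
Proof.
elim: r => [|m r IHr]; first by rewrite !big_nil mulg1.
rewrite rev_cons -cats1 big_cat big_seq1 big_cons /=.
by rewrite mulgA -[_ * rho_ m * rho_ m]mulgA rho_sq mulg1.
Qed.

Fact GVB_y_in_ker (i j : nat) : in_ker mu (GVB_y i j).
Proof.
apply/eqP; rewrite /GVB_y !gmulfM /= mu_s_ mulg1.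
by rewrite -gmulfM prod_rho_rev gmulf1.
Qed.

Definition y_index := {p : 'I_n * 'I_n | p.1 < p.2}.

Definition GH_y (p : y_index) : GH :=
  exist _ (GVB_y (val p).1 (val p).2) (GVB_y_in_ker _ _).

Definition free_y (k l : 'I_n) (kl : k < l) : freeGroup y_index :=
  free_gen (exist (fun p : 'I_n * 'I_n => p.1 < p.2) (k, l) kl).

Local Notation Y := free_y.

Inductive GH_rel : freeGroup y_index -> freeGroup y_index -> Prop :=
| GH_rel_sq (k l : 'I_n) (kl : k < l) :
    GH_rel (Y kl ^+ 2) 1
| GH_rel_comm (i j k l : 'I_n) (ij : i < j) (kl : k < l) :
    uniq [:: i; j; k; l] -> GH_rel ((Y ij * Y kl) ^+ 2) 1
| GH_rel_ik_kj (i j k : 'I_n) (ik : i < k) (kj : k < j) :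
    uniq [:: i; j; k] -> GH_rel ((Y ik * Y kj) ^+ 3) 1
| GH_rel_ij_kj (i j k : 'I_n) (ij : i < j) (kj : k < j) :
    uniq [:: i; j; k] -> GH_rel ((Y ij * Y kj) ^+ 3) 1
| GH_rel_ik_ij (i j k : 'I_n) (ik : i < k) (ij : i < j) :
    uniq [:: i; j; k] -> GH_rel ((Y ik * Y ij) ^+ 3) 1.

End VirtualBraids.

(* Main.v *)
Require Import Defs.
From HB Require Import structures.
From mathcomp Require Import all_boot all_fingroup.
From mathcomp Require Import boolp zify.

(* Let A be the presented group. The symmetric group S_n acts on A by         *)
(* permuting the indices of the generators, where y_(l,k) stands for y_(k,l), *)
(* and s_i |-> y_(i,i+1), rho_i |-> (i, i+1) defines a morphism from GVB_n to *)
(* the semidirect product of S_n and A. Conversely, the elements y_(k,l) of   *)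
(* GVB_n are permuted by the rho_i in the same way, so the relations of A     *)
(* need only be checked for one choice of indices; the resulting morphism     *)
(* A -> GH_n is injective, as it is split by the former one. It is surjective *)
(* since GVB_n is the product of the subgroup <rho_i> and of the image of A,  *)
(* and since <rho_i> meets ker mu trivially: this is the faithfulness of the  *)
(* Coxeter presentation of S_n, proved by induction on m with the cosets of   *)
(* <rho_0, ..., rho_(m-1)> in <rho_0, ..., rho_m>.                            *)

Set Implicit Arguments.
Unset Strict Implicit.
Unset Printing Implicit Defensive.

Local Open Scope group_scope.

(** The inverse of [pres_to_GH] is the second component of [sd_GVB]. It is a left inverse because
    the composite of [pres_to_GVB] and [sd_GVB] is the inclusion of A in the semidirect product
    ([sd_pres_to_GVB]). It is a right inverse because every x is r a with r a word in the rho_i and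
    a in the image of A ([GVB_rho_GH_decomp]): if mu x = 1 then mu r = 1, so r = 1 by
    [mu_rho_word_inj].

    The relations are handled through [coxeter_fam], a form of them invariant under relabelling:
    [coxeter_pres_y] gives it for A, and [coxeter_fam_rel] turns it back into the listed relations.
    In GVB_n, conjugation by rho_i relabels the y_(k,l) ([GVB_Y_rho]), so [coxeter_GVB_Y] only has
    to compare s_0 with itself, with s_1 and with s_2. *)

(** * Generalities on presentations, involutions and permutations *)

Lemma freeGroup_ind (X : choiceType) (P : freeGroup X -> Prop) :
  P 1 -> (forall a x, P a -> P (a * free_gen x)) ->
  (forall a x, P a -> P (a * (free_gen x)^-1)) -> forall a, P a.
Proof.
move=> P1 PM PV a; rewrite -[a]free_reprK.
elim/last_ind: (generic_quotient.repr a) => [|w [x e] IHw]; first exact: P1.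
rewrite -cats1 -free_mul_pi; case: e; first exact: PM.
have -> : free_pi [:: (x, false)] = (free_gen x)^-1.
  by rewrite [RHS]free_inv_pi.
exact: PV.
Qed.

Lemma groupQuot_ind (G : groupType) (R : G -> G -> Prop)
    (P : groupQuot R -> Prop) : (forall a, P (quot_pi R a)) -> forall x, P x.
Proof. by move=> Ppi x; rewrite -[x]quot_reprK. Qed.

Lemma presented_morphism_ext (X : choiceType)
    (R : freeGroup X -> freeGroup X -> Prop) (G : groupType)
    (f g : groupMorphism (groupQuot R) G) :
  (forall x, f (quot_pi R (free_gen x)) = g (quot_pi R (free_gen x))) ->
  f =1 g.
Proof.
move=> fg; elim/groupQuot_ind.
by elim/freeGroup_ind => [|a x IHa|a x IHa];
  rewrite ?gmulfM ?gmulfV ?gmulf1 //= IHa fg.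
Qed.

Lemma uniq3 (T : eqType) (i j k : T) :
  uniq [:: i; j; k] = [&& i != j, i != k & j != k].
Proof. by rewrite /= !inE negb_or andbT andbA. Qed.

Lemma expg_mulC (G : groupType) (a b : G) m :
  (a * b) ^+ m = 1 -> (b * a) ^+ m = 1.
Proof.
move=> ab1; have -> : b * a = (a * b) ^ a by rewrite conjgE !mulgA mulVg mul1g.
by rewrite -conjXg ab1 conj1g.
Qed.

Lemma commute_conjg (G : groupType) (x y : G) : commute x y -> x ^ y = x.
Proof. by move=> xy; apply/conjg_fixP/commgP. Qed.

Lemma braid_of_involutions (G : groupType) (a b : G) :
  a * a = 1 -> b * b = 1 -> (a * b) ^+ 3 = 1 -> a * b * a = b * a * b.
Proof.
move=> aa bb; rewrite !expgS expg0 mulg1 => ab3.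
have aV : a^-1 = a by exact/mulg1_eq.
have bV : b^-1 = b by exact/mulg1_eq.
apply/divg1_eq; rewrite !invgM aV bV -[RHS]ab3.
by rewrite !mulgA.
Qed.

Lemma commute_of_involutions (G : groupType) (a b : G) :
  a * a = 1 -> b * b = 1 -> (a * b) ^+ 2 = 1 -> a * b = b * a.
Proof.
move=> aa bb; rewrite expg2 => ab2.
have aV : a^-1 = a by exact/mulg1_eq.
have bV : b^-1 = b by exact/mulg1_eq.
by apply/divg1_eq; rewrite !invgM aV bV -[RHS]ab2.
Qed.

(** Take p for the tails and compose it with the transposition of p x and y; it moves no point of
    the tail of t, since those differ from both. *)
Lemma perm_uniq_trans (T : finType) (s t : seq T) :
  uniq s -> uniq t -> size s = size t -> exists p : {perm T}, map p s = t.
Proof.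
elim: s t => [|x s IHs] [|y t] //=; first by exists 1.
move=> /andP[xs us] /andP[yt ut] [/(IHs t us ut)[p pst]].
exists (p * tperm (p x) y); rewrite permM tpermL; congr cons.
rewrite -[RHS]pst; apply/eq_in_map => z zs; rewrite permM tpermD //.
  by rewrite (inj_eq perm_inj); apply: contraNneq xs => ->.
by apply: contraNneq yt => ->; rewrite -pst map_f.
Qed.

(** * The presented group and its symmetries *)

Section SymmetricFamily.
Variables (n : nat) (G : groupType).
Implicit Types (u : y_index n -> G) (U : 'I_n -> 'I_n -> G) (i j k l : 'I_n).

(* The family u, extended by u_(l,k) = u_(k,l) and by the junk value 1 on the *)
(* diagonal.                                                                  *)
Definition sym_fam u k l : G :=
  oapp u (oapp u 1 (insub (l, k))) (insub (k, l)).

Lemma sym_fam_lt u k l (kl : k < l) :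
  sym_fam u k l = u (exist (fun p : 'I_n * 'I_n => p.1 < p.2) (k, l) kl).
Proof. by rewrite /sym_fam (@insubT _ _ (y_index n) (k, l) kl). Qed.

Lemma sym_famC u k l : sym_fam u k l = sym_fam u l k.
Proof.
rewrite /sym_fam; case: (@insubP _ _ (y_index n) (k, l)) => [p /= kl _|_].
  by rewrite insubF //= ltnNge ltnW.
by case: insubP.
Qed.

Lemma sym_fam_diag u k : sym_fam u k k = 1.
Proof. by rewrite /sym_fam !insubF //= ltnn. Qed.

Lemma sym_fam_unique u U :
  (forall k, U k k = 1) -> (forall k l, U k l = U l k) ->
  (forall p : y_index n, U (val p).1 (val p).2 = u p) ->
  forall k l, sym_fam u k l = U k l.
Proof.
move=> Ud UC Uu k l; case: (ltngtP k l) => [kl|lk|/val_inj ->].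
- by rewrite sym_fam_lt -Uu.
- by rewrite sym_famC sym_fam_lt -Uu UC.
- by rewrite sym_fam_diag Ud.
Qed.

(** For a symmetric family the three cubic relations merge into one: two generators sharing exactly
    one index have a product of order dividing 3. *)
Definition coxeter_fam U :=
  [/\ forall k l, k != l -> U k l ^+ 2 = 1,
      forall i j k l, uniq [:: i; j; k; l] -> (U i j * U k l) ^+ 2 = 1
    & forall i j k, uniq [:: i; j; k] -> (U i j * U i k) ^+ 3 = 1].

Lemma coxeter_fam_perm U (p : 'S_n) :
  coxeter_fam U -> coxeter_fam (fun k l => U (p k) (p l)).
Proof.
case=> U2 UC U3; split=> [k l kl|i j k l ijkl|i j k ijk].
- by apply: U2; rewrite (inj_eq perm_inj).
- by apply: UC; rewrite -[_ :: _]/(map p [:: i; j; k; l]) map_inj_uniq //;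
    apply: perm_inj.
- by apply: U3; rewrite -[_ :: _]/(map p [:: i; j; k]) map_inj_uniq //;
    apply: perm_inj.
Qed.

Lemma eq_coxeter_fam U V : (forall k l, U k l = V k l) ->
  coxeter_fam U -> coxeter_fam V.
Proof. by move=> UV; have <- : U = V by apply/funext=> k; apply/funext. Qed.

Lemma coxeter_fam_rel u : coxeter_fam (sym_fam u) ->
  forall a b, GH_rel a b -> free_lift u a = free_lift u b.
Proof.
have Y k l (kl : k < l) : free_lift u (free_y kl) = sym_fam u k l.
  by rewrite free_lift_gen sym_fam_lt.
case=> U2 UC U3 a b; case=> {a b}
  [k l kl|i j k l ij kl uq|i j k ik kj uq|i j k ij kj uq|i j k ik ij uq];
  rewrite gmulfXn /= ?gmulfM /= ?Y gmulf1.
- by apply: U2; rewrite -val_eqE neq_ltn kl.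
- exact: UC.
- by rewrite sym_famC U3 //= !inE; move: uq; rewrite /= !inE -!val_eqE /=; lia.
- rewrite sym_famC [sym_fam u k j]sym_famC U3 //= !inE.
  by move: uq; rewrite /= !inE -!val_eqE /=; lia.
- by rewrite U3 //= !inE; move: uq; rewrite /= !inE -!val_eqE /=; lia.
Qed.

End SymmetricFamily.

Lemma coxeter_fam_inj n (G H : groupType) (f : groupMorphism G H)
    (U : 'I_n -> 'I_n -> G) :
  injective f -> coxeter_fam (fun k l => f (U k l)) -> coxeter_fam U.
Proof.
move=> f_inj [U2 UC U3]; split=> [k l kl|i j k l uq|i j k uq];
  apply: f_inj; rewrite gmulfXn gmulf1 ?gmulfM.
- exact: U2.
- exact: UC.
- exact: U3.
Qed.

Section PresentedGroup.
Variable n : nat.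
Implicit Types (i j k l : 'I_n) (p q : 'S_n).

Definition presGH := groupQuot (@GH_rel n).
HB.instance Definition _ := Group.on presGH.

Definition pres_gen (a : y_index n) : presGH :=
  quot_pi (@GH_rel n) (free_gen a).
Definition pres_y : 'I_n -> 'I_n -> presGH := sym_fam pres_gen.

Lemma pres_yC k l : pres_y k l = pres_y l k.
Proof. exact: sym_famC. Qed.

Lemma pres_y_lt k l (kl : k < l) : pres_y k l = quot_pi (@GH_rel n) (free_y kl).
Proof. exact: sym_fam_lt. Qed.

(** Swapping indices reduces to increasing pairs. For the cubic relation, whether the shared index
    is the least, the middle or the greatest of the three selects the defining relation. *)
Lemma coxeter_pres_y : coxeter_fam pres_y.
Proof.
have rel a b : GH_rel a b -> quot_pi (@GH_rel n) a = quot_pi (@GH_rel n) b.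
  exact: quot_pi_rel.
have pi1 : quot_pi (@GH_rel n) 1 = 1 by rewrite gmulf1.
split=> [k l|i j k l|i j k].
- wlog kl : k l / k < l => [IH kl|_].
    have := kl; rewrite -val_eqE neq_ltn => /orP[]; first by move/IH; apply.
    by rewrite pres_yC => /IH; apply; rewrite eq_sym.
  by rewrite pres_y_lt -gmulfXn /= (rel _ _ (GH_rel_sq kl)).
- wlog ij : i j / i < j => [IH uq|].
    case: (ltngtP i j) => [|ji|/val_inj ij]; first by move/IH; apply.
      rewrite pres_yC; apply: IH ji _.
      by move: uq; rewrite /= !inE -!val_eqE /=; lia.
    by move: uq; rewrite ij /= !inE eqxx.
  wlog kl : k l / k < l => [IH uq|uq].
    case: (ltngtP k l) => [|lk|/val_inj kl]; first by move/IH; apply.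
      rewrite [pres_y k l]pres_yC; apply: IH lk _.
      by move: uq; rewrite /= !inE -!val_eqE /=; lia.
    by move: uq; rewrite kl /= !inE eqxx /= !andbF.
  by rewrite !pres_y_lt -gmulfM -gmulfXn /= (rel _ _ (GH_rel_comm ij kl uq)).
(* A middle shared index arises for both orders of the two factors, hence this auxiliary
   statement. *)
- have between (a b c : 'I_n) : a < b -> b < c ->
      (pres_y b a * pres_y b c) ^+ 3 = 1.
    move=> ab bc; have uq : uniq [:: a; c; b].
      by rewrite uniq3 -!val_eqE /=; lia.
    rewrite pres_yC !pres_y_lt -gmulfM -gmulfXn /=.
    by rewrite (rel _ _ (GH_rel_ik_kj ab bc uq)).
  rewrite uniq3 -!val_eqE => /and3P[/= ij ik jk].
  case: (ltngtP i j) ij => // [ij|ji] _; case: (ltngtP i k) ik => // [ik|ki] _.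
  + have uq : uniq [:: i; k; j] by rewrite uniq3 -!val_eqE /=; lia.
    rewrite !pres_y_lt -gmulfM -gmulfXn /=.
    by rewrite (rel _ _ (GH_rel_ik_ij ij ik uq)).
  + exact/expg_mulC/between.
  + exact: between.
  + have uq : uniq [:: j; i; k] by rewrite uniq3 -!val_eqE /=; lia.
    rewrite ![pres_y i _]pres_yC !pres_y_lt -gmulfM -gmulfXn /=.
    by rewrite (rel _ _ (GH_rel_ij_kj ji ki uq)).
Qed.

Definition pres_act_gen p (a : y_index n) : presGH :=
  pres_y (p (val a).1) (p (val a).2).

Lemma sym_pres_act_gen p k l :
  sym_fam (pres_act_gen p) k l = pres_y (p k) (p l).
Proof.
apply: (@sym_fam_unique _ _ _ (fun k l => pres_y (p k) (p l))) k l => //.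
  by move=> k; apply: sym_fam_diag.
by move=> k l; apply: pres_yC.
Qed.

Fact pres_act_rel p a b :
  GH_rel a b -> free_lift (pres_act_gen p) a = free_lift (pres_act_gen p) b.
Proof.
apply: coxeter_fam_rel.
apply: eq_coxeter_fam (coxeter_fam_perm p coxeter_pres_y).
by move=> k l; rewrite sym_pres_act_gen.
Qed.

Definition pres_act p : presGH -> presGH := quot_lift (@pres_act_rel p).
HB.instance Definition _ p := UMagmaMorphism.on (pres_act p).

Lemma pres_act_y p k l : pres_act p (pres_y k l) = pres_y (p k) (p l).
Proof.
wlog kl : k l / k < l => [IH|].
  case: (ltngtP k l) => [|lk|/val_inj ->]; first exact: IH.
    by rewrite [pres_y k l]pres_yC IH // pres_yC.
  by rewrite /pres_y !sym_fam_diag gmulf1.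
by rewrite pres_y_lt [LHS](quot_lift_pi (@pres_act_rel p)) /= free_lift_gen.
Qed.

Lemma pres_act_gen_eq p a : pres_act p (pres_gen a) = pres_act_gen p a.
Proof.
by rewrite [LHS](quot_lift_pi (@pres_act_rel p)) /= free_lift_gen.
Qed.

Lemma pres_act1 a : pres_act 1 a = a.
Proof.
apply: (@presented_morphism_ext _ _ _ (pres_act 1) idfun) a => x /=.
rewrite [LHS]pres_act_gen_eq /pres_act_gen !perm1.
by case: x => -[k l] kl; rewrite [LHS]pres_y_lt.
Qed.

(** Products of permutations apply the left factor first, so this is a right action, as the exponent
    notation a^p requires. *)
Lemma pres_actM p q a : pres_act (p * q) a = pres_act q (pres_act p a).
Proof.
apply: (@presented_morphism_ext _ _ _ (pres_act (p * q))
         (pres_act q \o pres_act p)) a => x /=.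
by rewrite ![pres_act _ (quot_pi _ _)]pres_act_gen_eq /pres_act_gen
  pres_act_y !permM.
Qed.

End PresentedGroup.

(** * The morphism from GVB_n to the semidirect product *)

Section SemidirectProduct.
Variable n : nat.

(* The pair (p, a) stands for the product p a, and a^p = pres_act p a.        *)
Definition sdGH := ('S_n * presGH n)%type.
HB.instance Definition _ := Choice.on sdGH.
Implicit Types x y z : sdGH.

Definition sd_one : sdGH := (1, 1).
Definition sd_mul x y : sdGH := (x.1 * y.1, pres_act y.1 x.2 * y.2).
Definition sd_inv x : sdGH := (x.1^-1, pres_act x.1^-1 x.2^-1).

Fact sd_mulA : associative sd_mul.
Proof.
by move=> x y z; congr pair; rewrite /= ?mulgA // gmulfM /= pres_actM.
Qed.

Fact sd_mul1g : left_id sd_one sd_mul.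
Proof. by move=> [p a]; congr pair; rewrite /= ?gmulf1 ?mul1g. Qed.

Fact sd_mulg1 : right_id sd_one sd_mul.
Proof. by move=> [p a]; congr pair; rewrite /= ?pres_act1 ?mulg1. Qed.

Fact sd_mulVg : left_inverse sd_one sd_inv sd_mul.
Proof.
by move=> [p a]; congr pair; rewrite /= -?pres_actM ?mulVg ?pres_act1 ?mulVg.
Qed.

Fact sd_mulgV : right_inverse sd_one sd_inv sd_mul.
Proof.
by move=> [p a]; congr pair; rewrite /= -?gmulfM ?mulgV ?gmulf1.
Qed.

HB.instance Definition _ := isGroup.Build sdGH
  sd_mulA sd_mul1g sd_mulg1 sd_mulVg sd_mulgV.

Definition sd_perm (p : 'S_n) : sdGH := (p, 1).
Definition sd_pres (a : presGH n) : sdGH := (1, a).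

Fact sd_perm_is_multiplicative : {morph sd_perm : p q / p * q}.
Proof. by move=> p q; congr pair; rewrite /= ?gmulf1 ?mulg1. Qed.
HB.instance Definition _ := isUMagmaMorphism.Build 'S_n sdGH sd_perm
  (group_morphism sd_perm_is_multiplicative).

Fact sd_pres_is_multiplicative : {morph sd_pres : a b / a * b}.
Proof. by move=> a b; congr pair; rewrite /= ?pres_act1 ?mulg1. Qed.
HB.instance Definition _ := isUMagmaMorphism.Build (presGH n) sdGH sd_pres
  (group_morphism sd_pres_is_multiplicative).

Lemma sd_presC a p : sd_pres a * sd_perm p = sd_perm p * sd_pres (pres_act p a).
Proof. by congr pair; rewrite /= ?gmulf1 !(mulg1, mul1g). Qed.

Lemma sd_presJ a p : sd_pres a ^ sd_perm p = sd_pres (pres_act p a).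
Proof. by rewrite conjgE sd_presC mulKg. Qed.

End SemidirectProduct.

Section VirtualBraidsToSemidirect.
Variable n : nat.
Implicit Types i j : 'I_n.-1.

Definition pt_lo i : 'I_n := Ordinal (pt_lo_proof i).
Definition pt_hi i : 'I_n := Ordinal (pt_hi_proof i).

Lemma adj_tpermE i (k : 'I_n) :
  adj_tperm i k = (if k == i :> nat then i.+1 else
                   if k == i.+1 :> nat then i : nat else k) :> nat.
Proof.
rewrite permE /= -!val_eqE /=.
by case: eqP => // _; case: eqP.
Qed.

Lemma adj_tperm_sq i : adj_tperm i * adj_tperm i = 1.
Proof. exact: tperm2. Qed.

Definition sd_gen (x : 'I_n.-1 + 'I_n.-1) : sdGH n :=
  match x with
  | inl i => sd_pres (pres_y (pt_lo i) (pt_hi i))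
  | inr i => sd_perm (adj_tperm i)
  end.

Lemma pt_lo_hi i : pt_lo i != pt_hi i.
Proof. by rewrite -val_eqE /= neq_ltn ltnSn. Qed.

Lemma pres_y_sq (k l : 'I_n) : k != l -> pres_y k l * pres_y k l = 1.
Proof. by case: (coxeter_pres_y n) => U2 _ _ /U2; rewrite expg2. Qed.

Lemma sd_presM (a b : presGH n) : sd_pres a * sd_pres b = sd_pres (a * b).
Proof. by rewrite gmulfM. Qed.

Lemma sd_permM (p q : 'S_n) : sd_perm p * sd_perm q = sd_perm (p * q).
Proof. by rewrite gmulfM. Qed.

Lemma far_uniq i j : far i j -> uniq [:: pt_lo i; pt_hi i; pt_lo j; pt_hi j].
Proof. by rewrite /far /= !inE -!val_eqE /=; lia. Qed.

Fact sd_VB_rel a b : VB_rel a b -> free_lift sd_gen a = free_lift sd_gen b.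
Proof.
have E x : free_lift sd_gen (free_gen x) = sd_gen x by rewrite free_lift_gen.
case: (coxeter_pres_y n) => U2 UC U3.
case=> {a b} [i j ij|i j ij|i j ij|i j ij|i|i j ij|i j ij];
  rewrite /free_sigma /free_rho ?expg2 !gmulfM ?gmulf1 /= !E /=
          ?sd_presM ?sd_permM.
- congr sd_pres.
  have -> : pt_lo j = pt_hi i by apply: val_inj.
  apply: braid_of_involutions; rewrite ?pres_y_sq ?pt_lo_hi //.
    by rewrite -val_eqE /=; lia.
  by rewrite [pres_y (pt_lo i) _]pres_yC U3 // uniq3 -!val_eqE /=; lia.
- congr sd_pres; apply: commute_of_involutions; rewrite ?pres_y_sq ?pt_lo_hi //.
  exact/UC/far_uniq.
- by rewrite adj_tperm_braid.
- by rewrite adj_tperm_far.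
- by rewrite adj_tperm_sq gmulf1.
- rewrite sd_presC pres_act_y; congr (_ * sd_pres (pres_y _ _));
    by apply: ord_inj; rewrite adj_tpermE /=;
      move: ij; rewrite /far; do !case: eqP; lia.
(* Relation (M): applying (i, i+1) and then (i+1, i+2) sends i+1 to i and i+2 to i+1. *)
- rewrite -[RHS]mulgA sd_permM sd_presC pres_act_y.
  by congr (_ * sd_pres (pres_y _ _)); apply: ord_inj;
    rewrite permM !adj_tpermE /=; do !case: eqP; lia.
Qed.
Definition sd_VB : VB n -> sdGH n := quot_lift sd_VB_rel.
HB.instance Definition _ := UMagmaMorphism.on sd_VB.

Lemma sd_VB_sigma i : sd_VB (VB_sigma i) = sd_gen (inl i).
Proof. by rewrite [LHS](quot_lift_pi sd_VB_rel) /= free_lift_gen. Qed.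

Lemma sd_VB_rho i : sd_VB (VB_rho i) = sd_gen (inr i).
Proof. by rewrite [LHS](quot_lift_pi sd_VB_rel) /= free_lift_gen. Qed.

Fact sd_FVB_rel a b : FVB_rel a b -> sd_VB a = sd_VB b.
Proof.
case=> i; rewrite expg2 gmulfM gmulf1 /= sd_VB_sigma /= sd_presM.
by rewrite pres_y_sq ?pt_lo_hi ?gmulf1.
Qed.
Definition sd_FVB : FVB n -> sdGH n := quot_lift sd_FVB_rel.
HB.instance Definition _ := UMagmaMorphism.on sd_FVB.

Lemma sd_FVB_s i : sd_FVB (FVB_s i) = sd_gen (inl i).
Proof. by rewrite [LHS](quot_lift_pi sd_FVB_rel) /= sd_VB_sigma. Qed.

Lemma sd_FVB_rho i : sd_FVB (FVB_rho i) = sd_gen (inr i).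
Proof. by rewrite [LHS](quot_lift_pi sd_FVB_rel) /= sd_VB_rho. Qed.

(** The transposition (i, i+1) exchanges the two indices of y_(i,i+1), which the symmetric extension
    absorbs. *)
Fact sd_GVB_rel a b : GVB_rel a b -> sd_FVB a = sd_FVB b.
Proof.
case=> i; rewrite !gmulfM /= sd_FVB_s sd_FVB_rho sd_presC pres_act_y.
by rewrite tpermL tpermR pres_yC.
Qed.
Definition sd_GVB : GVB n -> sdGH n := quot_lift sd_GVB_rel.
HB.instance Definition _ := UMagmaMorphism.on sd_GVB.

Lemma sd_GVB_s i : sd_GVB (GVB_s i) = sd_pres (pres_y (pt_lo i) (pt_hi i)).
Proof. by rewrite [LHS](quot_lift_pi sd_GVB_rel) /= sd_FVB_s. Qed.

Lemma sd_GVB_rho i : sd_GVB (GVB_rho i) = sd_perm (adj_tperm i).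
Proof. by rewrite [LHS](quot_lift_pi sd_GVB_rel) /= sd_FVB_rho. Qed.

End VirtualBraidsToSemidirect.

(** * The elements y_(k,l) of GVB_n *)

Section GaussRelations.
Variable n : nat.
Local Notation G := (GVB n).
Local Notation s_ m := (@s_ n m).
Local Notation rho_ m := (@rho_ n m).
Implicit Types i j k m : nat.

Definition GVB_pi (a : freeGroup ('I_n.-1 + 'I_n.-1)%type) : G :=
  quot_pi (@GVB_rel n) (quot_pi (@FVB_rel n) (quot_pi (@VB_rel n) a)).

Lemma GVB_piM a b : GVB_pi (a * b) = GVB_pi a * GVB_pi b.
Proof. by rewrite /GVB_pi !gmulfM. Qed.

Lemma GVB_pi_rel a b : VB_rel a b -> GVB_pi a = GVB_pi b.
Proof. by move=> ab; rewrite /GVB_pi (quot_pi_rel ab). Qed.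

Lemma GVB_s_sq (a : 'I_n.-1) : GVB_s a * GVB_s a = 1.
Proof.
have FVB_s_sq : FVB_s a * FVB_s a = 1.
  by have := quot_pi_rel (FVB_sq a); rewrite expg2 gmulfM gmulf1.
by rewrite /GVB_s -gmulfM /= FVB_s_sq gmulf1.
Qed.

(** All generators are involutions, so no case for inverses arises. *)
Lemma GVB_ind (P : G -> Prop) :
  P 1 -> (forall x (a : 'I_n.-1), P x -> P (x * GVB_s a)) ->
  (forall x (a : 'I_n.-1), P x -> P (x * GVB_rho a)) -> forall x, P x.
Proof.
move=> P1 Ps Pr; do 3![elim/groupQuot_ind].
have Pgen x y : P x -> P (x * GVB_pi (free_gen y)).
  by move=> Px; case: y => i; [apply: Ps | apply: Pr].
have piV y : GVB_pi (free_gen y)^-1 = GVB_pi (free_gen y).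
  have -> : GVB_pi (free_gen y)^-1 = (GVB_pi (free_gen y))^-1.
    by rewrite /GVB_pi !gmulfV.
  by apply/mulg1_eq; case: y => i; [apply: GVB_s_sq | apply: GVB_rho_sq].
elim/freeGroup_ind => [|a y IHa|a y IHa]; first by rewrite !gmulf1.
  by rewrite -/(GVB_pi _) GVB_piM; apply: Pgen.
by rewrite -/(GVB_pi _) GVB_piM piV; apply: Pgen.
Qed.

Lemma s_ord (a : 'I_n.-1) : s_ a = GVB_s a.
Proof. by rewrite /Defs.s_ valK. Qed.

Lemma rho_ord (a : 'I_n.-1) : rho_ a = GVB_rho a.
Proof. by rewrite /Defs.rho_ valK. Qed.

(** Since the default value is central, the commutation lemmas below hold without bounds; the braid
    and mixed relations keep theirs. *)
Lemma rho_junk m : n.-1 <= m -> rho_ m = 1.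
Proof. by move=> nm; rewrite /Defs.rho_ insubF // ltnNge nm. Qed.

Lemma s_junk m : n.-1 <= m -> s_ m = 1.
Proof. by move=> nm; rewrite /Defs.s_ insubF // ltnNge nm. Qed.

Lemma s_sq m : s_ m * s_ m = 1.
Proof.
by rewrite /Defs.s_; case: insubP => [k _ _|_] /=; rewrite ?GVB_s_sq ?mulg1.
Qed.

Lemma rhoV m : (rho_ m)^-1 = rho_ m.
Proof. exact/mulg1_eq/rho_sq. Qed.

Lemma rho_far i j : i.+1 < j -> commute (rho_ i) (rho_ j).
Proof.
move=> ij; have [nj|jn] := leqP n.-1 j.
  by rewrite (rho_junk nj); apply: commute1.
pose a := Ordinal (ltn_trans (ltnW ij) jn); pose b := Ordinal jn.
have /VB_R4/GVB_pi_rel : far a b by rewrite /far ij.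
by rewrite !GVB_piM -[i]/(val a) -[j]/(val b) !rho_ord.
Qed.

Lemma s_rho_far i j : (i.+1 < j) || (j.+1 < i) -> commute (s_ i) (rho_ j).
Proof.
move=> ij; have [nj|jn] := leqP n.-1 j.
  by rewrite (rho_junk nj); apply: commute1.
have [ni|in_] := leqP n.-1 i.
  by rewrite (s_junk ni); apply/commute_sym/commute1.
pose a := Ordinal in_; pose b := Ordinal jn.
have /VB_R6/GVB_pi_rel : far a b by [].
by rewrite !GVB_piM -[i]/(val a) -[j]/(val b) rho_ord s_ord.
Qed.

Lemma s_far i j : i.+1 < j -> commute (s_ i) (s_ j).
Proof.
move=> ij; have [nj|jn] := leqP n.-1 j.
  by rewrite (s_junk nj); apply: commute1.
pose a := Ordinal (ltn_trans (ltnW ij) jn); pose b := Ordinal jn.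
have /VB_R2/GVB_pi_rel : far a b by rewrite /far ij.
by rewrite !GVB_piM -[i]/(val a) -[j]/(val b) !s_ord.
Qed.

Lemma s_rho i : commute (s_ i) (rho_ i).
Proof.
have [ni|in_] := leqP n.-1 i.
  by rewrite (rho_junk ni); apply: commute1.
have := quot_pi_rel (GVB_comm (Ordinal in_)).
by rewrite !gmulfM -[i]/(val (Ordinal in_)) rho_ord s_ord.
Qed.

Lemma rho_braid i : i.+2 < n ->
  rho_ i * rho_ i.+1 * rho_ i = rho_ i.+1 * rho_ i * rho_ i.+1.
Proof.
move=> lt_in; have ltb : i.+1 < n.-1 by lia.
pose a := Ordinal (ltnW ltb); pose b := Ordinal ltb.
have /GVB_pi_rel := @VB_R3 n a b erefl.
by rewrite !GVB_piM -[i]/(val a) -[(val a).+1]/(val b) !rho_ord.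
Qed.

Lemma s_braid i : i.+2 < n -> s_ i * s_ i.+1 * s_ i = s_ i.+1 * s_ i * s_ i.+1.
Proof.
move=> lt_in; have ltb : i.+1 < n.-1 by lia.
pose a := Ordinal (ltnW ltb); pose b := Ordinal ltb.
have /GVB_pi_rel := @VB_R1 n a b erefl.
by rewrite !GVB_piM -[i]/(val a) -[(val a).+1]/(val b) !s_ord.
Qed.

Lemma s_mixed i : i.+2 < n -> s_ i ^ (rho_ i.+1 * rho_ i) = s_ i.+1.
Proof.
move=> lt_in; have ltb : i.+1 < n.-1 by lia.
have E : rho_ i * rho_ i.+1 * s_ i = s_ i.+1 * rho_ i * rho_ i.+1.
  pose a := Ordinal (ltnW ltb); pose b := Ordinal ltb.
  have /GVB_pi_rel := @VB_M n a b erefl.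
  by rewrite !GVB_piM -[i]/(val a) -[(val a).+1]/(val b) !rho_ord !s_ord.
rewrite conjgE invgM !rhoV mulgA E -!mulgA.
rewrite [rho_ i.+1 * (_ * _)]mulgA rho_sq mul1g.
by rewrite rho_sq mulg1.
Qed.

Lemma GVB_yE i j : GVB_y n i j = s_ i ^ (\prod_(i.+1 <= m < j) rho_ m).
Proof.
rewrite /GVB_y conjgE mulgA.
by rewrite -(mulg1_eq (prod_rho_rev n (index_iota i.+1 j))) invgK.
Qed.

Lemma GVB_y_base i : GVB_y n i i.+1 = s_ i.
Proof. by rewrite GVB_yE big_geq // conjg1. Qed.

Lemma GVB_y_recr i j : i < j -> GVB_y n i j.+1 = GVB_y n i j ^ rho_ j.
Proof. by move=> ij; rewrite !GVB_yE big_nat_recr //= conjgM. Qed.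

Lemma conj_rhoK x y m : x ^ rho_ m = y -> y ^ rho_ m = x.
Proof. by move=> <-; rewrite -conjgM rho_sq conjg1. Qed.

Lemma GVB_y_rho_out i j m : i < j -> (m.+1 < i) || (j < m) ->
  GVB_y n i j ^ rho_ m = GVB_y n i j.
Proof.
elim: j => // j IHj; rewrite ltnS leq_eqVlt => /orP[/eqP <- mij|ij mij].
  by rewrite GVB_y_base; apply/commute_conjg/s_rho_far; lia.
rewrite GVB_y_recr // -conjgM.
have -> : rho_ j * rho_ m = rho_ m * rho_ j.
  by case/orP: mij => mij; [apply: commute_sym|]; apply: rho_far; lia.
by rewrite conjgM IHj //; lia.
Qed.

Lemma GVB_y_rho_in i j m : i < m -> m.+1 < j -> j < n ->
  GVB_y n i j ^ rho_ m = GVB_y n i j.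
Proof.
move=> im; elim: j => // j IHj; rewrite ltnS leq_eqVlt.
move=> /orP[/eqP <- mn|mj jn].
  (* Here y_(i,m+2) is y_(i,m) conjugated by rho_m rho_(m+1). A further rho_m turns this, by the
     braid relation, into rho_(m+1) rho_m rho_(m+1), whose first letter fixes y_(i,m). *)
  rewrite !GVB_y_recr //; last exact: ltnW.
  rewrite -!conjgM mulgA rho_braid // -mulgA [LHS]conjgM.
  by rewrite GVB_y_rho_out ?ltnSn ?orbT.
rewrite GVB_y_recr; last by lia.
by rewrite -conjgM -rho_far // conjgM IHj //; lia.
Qed.

Lemma GVB_y_rho_first i j : i.+1 < j -> j < n ->
  GVB_y n i j ^ rho_ i = GVB_y n i.+1 j.
Proof.
elim: j => // j IHj; rewrite ltnS leq_eqVlt => /orP[/eqP <- mn|ij jn].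
  by rewrite GVB_y_recr // !GVB_y_base -conjgM s_mixed.
rewrite !GVB_y_recr //; last exact: ltnW.
by rewrite -conjgM -rho_far // conjgM IHj //; lia.
Qed.

Definition GVB_gen (p : y_index n) : G := GVB_y n (val p).1 (val p).2.
Definition GVB_Y : 'I_n -> 'I_n -> G := sym_fam GVB_gen.

Lemma GVB_Y_lt (k l : 'I_n) : k < l -> GVB_Y k l = GVB_y n k l.
Proof. by move=> kl; rewrite /GVB_Y sym_fam_lt. Qed.

Lemma GVB_YC (k l : 'I_n) : GVB_Y k l = GVB_Y l k.
Proof. exact: sym_famC. Qed.

(** The cases are the positions of {a, a+1} relative to k < l: outside, strictly between, meeting
    {k, l} in one point, or equal to it. *)
Lemma GVB_Y_rho (k l : 'I_n) (a : 'I_n.-1) :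
  GVB_Y k l ^ GVB_rho a = GVB_Y (adj_tperm a k) (adj_tperm a l).
Proof.
wlog kl : k l / k < l => [IH|].
  case: (ltngtP k l) => [|lk|/val_inj ->]; first exact: IH.
    by rewrite GVB_YC IH // GVB_YC.
  by rewrite /GVB_Y !sym_fam_diag conj1g.
have ln := ltn_ord l; have an := ltn_ord a.
have ak := adj_tpermE a k; have al := adj_tpermE a l.
have Y x y : x < y -> adj_tperm a k = x :> nat -> adj_tperm a l = y :> nat ->
    GVB_Y (adj_tperm a k) (adj_tperm a l) = GVB_y n x y.
  by move=> xy kx ly; rewrite GVB_Y_lt kx ly.
rewrite -rho_ord (GVB_Y_lt kl).
have [out|] := boolP ((a.+1 < k) || (l < a)).
  rewrite GVB_y_rho_out // (Y k l) // ?ak ?al; do !case: eqP; lia.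
rewrite negb_or -!leqNgt => /andP[ka la].
case: (ltngtP a k) => [ltak|ltka|eqak].
- have eqk : k = a.+1 :> nat by lia.
  rewrite eqk (Y a l) ?ak ?al; try by do ?case: eqP; lia.
  by apply/conj_rhoK; rewrite GVB_y_rho_first -?eqk.
- case: (ltngtP a.+1 l) => [lt_al|gt_al|eqal].
  + rewrite GVB_y_rho_in // (Y k l) // ?ak ?al; do !case: eqP; lia.
  + have eql : l = a :> nat by lia.
    rewrite eql -GVB_y_recr // (Y k a.+1) // ?ak ?al; do ?case: eqP; lia.
  + rewrite -eqal (Y k a) ?ak ?al; try by do ?case: eqP; lia.
    by apply/conj_rhoK; rewrite -GVB_y_recr.
- case: (ltngtP k.+1 l) => [lt_kl|gt_kl|eqkl]; [|lia|].
  + rewrite eqak GVB_y_rho_first // (Y k.+1 l) // ?ak ?al; do ?case: eqP; lia.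
  (* The indices are swapped, and the claim becomes the relation that s_a and rho_a commute. *)
  + have -> : adj_tperm a k = l by apply: ord_inj; rewrite ak eqak eqxx eqkl.
    have -> : adj_tperm a l = k.
      by apply: ord_inj; rewrite al eqak -eqkl; do !case: eqP; lia.
    rewrite GVB_YC GVB_Y_lt // -eqkl GVB_y_base -eqak.
    exact/commute_conjg/s_rho.
Qed.

End GaussRelations.

Lemma adj_tperm_ind n (P : 'S_n -> Prop) :
  P 1 -> (forall p (a : 'I_n.-1), P p -> P (p * adj_tperm a)) -> forall p, P p.
Proof.
move=> P1 Padj.
have Pt d (k l : 'I_n) p : l = (k + d).+1 :> nat -> P p -> P (p * tperm k l).
  elim: d l p => [|d IHd] l p lkd Pp.
    have kn : k < n.-1 by have := ltn_ord l; lia.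
    suff -> : tperm k l = adj_tperm (Ordinal kn) by exact: Padj.
    by congr tperm; apply: ord_inj; rewrite //= lkd addn0.
  have an : (k + d).+1 < n.-1 by have := ltn_ord l; lia.
  pose a := Ordinal an; have av : a = (k + d).+1 :> nat by [].
  (* With a = l - 1, conjugation by (l-1, l) turns (k, l-1) into (k, l), shortening the distance by
     one. *)
  have -> : tperm k l = adj_tperm a * tperm k (pt_lo a) * adj_tperm a.
    have aV : (adj_tperm a)^-1 = adj_tperm a by exact/mulg1_eq/adj_tperm_sq.
    rewrite -{1}aV -mulgA -[RHS]/(tperm _ _ ^ _) tpermJ tpermL.
    by congr tperm; apply: ord_inj; rewrite ?adj_tpermE /=;
      do ?case: eqP => //; lia.
  by rewrite !mulgA; apply/Padj/IHd/Padj.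
have PtP (k l : 'I_n) p : k != l -> P p -> P (p * tperm k l).
  rewrite -val_eqE neq_ltn /= => /orP[kl|lk]; [|rewrite tpermC].
    by apply: (Pt (l - k.+1)); lia.
  by apply: (Pt (k - l.+1)); lia.
move=> p; have [ts -> tsP] := prod_tpermP p.
elim/last_ind: ts tsP => [|ts t IHts]; first by rewrite big_nil.
rewrite all_rcons => /andP[t12 /IHts Pts].
by rewrite -cats1 big_cat big_seq1; apply: PtP.
Qed.

(** * The relations among the y_(k,l) in GVB_n and the map from the presented group *)

Section GaussCoxeter.
Variable n : nat.
Local Notation G := (GVB n).

Lemma GVB_Y_conj (p : 'S_n) :
  exists r : G, forall k l, GVB_Y (p k) (p l) = GVB_Y k l ^ r.
Proof.
elim/adj_tperm_ind: p => [|p a [r Yr]].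
  by exists 1 => k l; rewrite !perm1 conjg1.
by exists (r * GVB_rho a) => k l; rewrite conjgM -Yr GVB_Y_rho !permM.
Qed.

Lemma uniq_ord_size (s : seq 'I_n) : uniq s -> size s <= n.
Proof. by move=> /card_uniqP <-; rewrite -[n in _ <= n]card_ord max_card. Qed.

Lemma coxeter_GVB_Y : coxeter_fam (@GVB_Y n).
Proof.
have Ys (k l : 'I_n) : l = k.+1 :> nat -> GVB_Y k l = @s_ n k.
  by move=> lk; rewrite GVB_Y_lt lk // GVB_y_base.
split=> [k l kl|i j k l uq|i j k uq].
- have uq : uniq [:: k; l] by rewrite /= inE kl.
  have n2 := uniq_ord_size uq.
  pose a := Ordinal (ltnW n2); pose b := Ordinal n2.
  have [//|//|//|p [<- <-]] := @perm_uniq_trans _ [:: a; b] [:: k; l].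
  have [r ->] := GVB_Y_conj p.
  by rewrite -conjXg (Ys a b) // expg2 s_sq conj1g.
- have n4 := uniq_ord_size uq.
  pose a := Ordinal (ltnW (ltnW (ltnW n4))); pose b := Ordinal (ltnW (ltnW n4)).
  pose c := Ordinal (ltnW n4); pose d := Ordinal n4.
  have [//|//|//|p [<- <- <- <-]] :=
    @perm_uniq_trans _ [:: a; b; c; d] [:: i; j; k; l].
  have [r Yr] := GVB_Y_conj p; rewrite !Yr.
  rewrite -conjMg -conjXg (Ys a b) // (Ys c d) //.
  rewrite expgMn; last exact: s_far.
  by rewrite !expg2 !s_sq mulg1 conj1g.
- have n3 := uniq_ord_size uq.
  pose a := Ordinal (ltnW (ltnW n3)); pose b := Ordinal (ltnW n3).
  pose c := Ordinal n3.
  (* The shared index i is matched with the middle point 1, so that the two generators become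
     y_(0,1) = s_0 and y_(1,2) = s_1. *)
  have [//|//|//|p [<- <- <-]] :=
    @perm_uniq_trans _ [:: b; a; c] [:: i; j; k].
  have [r Yr] := GVB_Y_conj p; rewrite !Yr.
  rewrite -conjMg -conjXg GVB_YC (Ys a b) // (Ys b c) //=.
  have -> : (@s_ n 0 * @s_ n 1) ^+ 3 = 1.
    rewrite !expgS expg0 mulg1 !mulgA s_braid //.
    rewrite -!mulgA (mulgA (@s_ n 1) (@s_ n 1)) s_sq mul1g.
    by rewrite (mulgA (@s_ n 0)) s_sq mul1g s_sq.
  by rewrite conj1g.
Qed.

Fact GH_y_rel a b :
  GH_rel a b -> free_lift (@GH_y n) a = free_lift (@GH_y n) b.
Proof.
apply: coxeter_fam_rel.
have val_Y k l : val (sym_fam (@GH_y n) k l) = GVB_Y k l.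
  rewrite /GVB_Y; apply/esym.
  apply: (@sym_fam_unique _ _ _ (fun k l => val (sym_fam (@GH_y n) k l))) k l.
  - by move=> k; rewrite sym_fam_diag.
  - by move=> k l; rewrite sym_famC.
  - by case=> -[k l] kl; rewrite sym_fam_lt.
apply: (@coxeter_fam_inj _ _ _ (val : groupMorphism (GH n) G)).
  exact: val_inj.
by apply: eq_coxeter_fam coxeter_GVB_Y => k l; rewrite -val_Y.
Qed.

Definition pres_to_GH : presGH n -> GH n := quot_lift GH_y_rel.
HB.instance Definition _ := UMagmaMorphism.on pres_to_GH.

Lemma pres_to_GH_gen p : pres_to_GH (pres_gen p) = GH_y p.
Proof. by rewrite [LHS](quot_lift_pi GH_y_rel) /= free_lift_gen. Qed.

Definition pres_to_GVB (a : presGH n) : G := val (pres_to_GH a).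

Fact pres_to_GVB_is_multiplicative : {morph pres_to_GVB : a b / a * b}.
Proof. by move=> a b; rewrite /pres_to_GVB gmulfM. Qed.
HB.instance Definition _ := isUMagmaMorphism.Build (presGH n) G pres_to_GVB
  (group_morphism pres_to_GVB_is_multiplicative).

Lemma pres_to_GVB_y k l : pres_to_GVB (pres_y k l) = GVB_Y k l.
Proof.
rewrite /GVB_Y; apply/esym.
apply: (@sym_fam_unique _ _ _ (fun k l => pres_to_GVB (pres_y k l))) k l.
- by move=> k; rewrite /pres_y sym_fam_diag gmulf1.
- by move=> k l; rewrite pres_yC.
- case=> -[k l] kl; rewrite /pres_y sym_fam_lt /pres_to_GVB.
  by rewrite pres_to_GH_gen.
Qed.

(** Both sides are morphisms in a, and they agree on generators by [GVB_Y_rho]. *)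
Lemma pres_to_GVB_rho a i :
  pres_to_GVB a ^ GVB_rho i = pres_to_GVB (pres_act (adj_tperm i) a).
Proof.
have conj_mul : {morph (fun a => pres_to_GVB a ^ GVB_rho i) : a b / a * b}.
  by move=> b c; rewrite gmulfM conjMg.
pose h := fun a => pres_to_GVB a ^ GVB_rho i.
pose H := isUMagmaMorphism.Build (presGH n) G h (group_morphism conj_mul).
pose h' : groupMorphism (presGH n) G := HB.pack h H.
apply: (@presented_morphism_ext _ _ _ h'
         (pres_to_GVB \o pres_act (adj_tperm i))).
case=> -[k l] kl /=; rewrite -[quot_pi _ _]pres_y_lt.
by rewrite /h' /= /h pres_act_y !pres_to_GVB_y GVB_Y_rho.
Qed.

Lemma sd_pres_to_GVB a : sd_GVB (pres_to_GVB a) = sd_pres a.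
Proof.
apply: (@presented_morphism_ext _ _ _ (@sd_GVB n \o pres_to_GVB)
         (@sd_pres n)) a => a.
case: a => -[k l] /= kl; rewrite -[quot_pi _ _]pres_y_lt pres_to_GVB_y.
rewrite GVB_Y_lt //=.
(* Induction on the distance: y_(k,l+1) is y_(k,l) conjugated by rho_l, and [sd_GVB] sends this to
   the action of (l, l+1). *)
have [d ld] : {d | l = (k + d).+1 :> nat} by exists (l - k.+1); lia.
elim: d l kl ld => [|d IHd] l kl ld.
  have kn : k < n.-1 by have := ltn_ord l; lia.
  rewrite ld addn0 GVB_y_base -[k : nat]/(val (Ordinal kn)) s_ord sd_GVB_s.
  by congr (sd_pres (pres_y _ _)); apply: ord_inj => //=; rewrite ld addn0.
have an : (k + d).+1 < n.-1 by have := ltn_ord l; lia.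
pose a := Ordinal an; have av : a = (k + d).+1 :> nat by [].
rewrite ld addnS GVB_y_recr; last by lia.
rewrite -[(k + d).+1]/(val a) rho_ord gmulfJ /= sd_GVB_rho.
rewrite -[(k + d).+1]/(nat_of_ord (pt_lo a)) IHd //=; last first.
  by rewrite ltnS leq_addr.
rewrite sd_presJ pres_act_y; congr (sd_pres (pres_y _ _)); apply: ord_inj;
  by rewrite adj_tpermE /=; do ?case: eqP => //; lia.
Qed.

End GaussCoxeter.

(** * The subgroup generated by the rho_i *)

Section RhoSubgroup.
Variable n : nat.
Local Notation G := (GVB n).
Local Notation rho_ m := (@rho_ n m).
Implicit Types i k m : nat.

(** This is the whole subgroup generated by rho_0, ..., rho_(m-1), as these are involutions. *)
Inductive rho_word m : G -> Prop :=
| rho_word1 : rho_word m 1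
| rho_wordM x i : rho_word m x -> i < m -> rho_word m (x * rho_ i).

(** The words rho_(m-1) ... rho_k, for k <= m, represent the cosets of [rho_word m.-1] in
    [rho_word m]. *)
Definition rho_desc m k : G := \prod_(i <- rev (index_iota k m)) rho_ i.

Lemma rho_desc_refl m : rho_desc m m = 1.
Proof. by rewrite /rho_desc /index_iota subnn big_nil. Qed.

Lemma rho_descS m k : k < m -> rho_desc m k = rho_desc m k.+1 * rho_ k.
Proof.
move=> km; rewrite /rho_desc /index_iota subnS -(prednK (_ : 0 < m - k)).
  by rewrite /= rev_cons -cats1 big_cat big_seq1.
by rewrite subn_gt0.
Qed.

Lemma rho_desc_far m k i : i.+1 < k -> k <= m ->
  commute (rho_ i) (rho_desc m k).
Proof.
move=> ik /subnK <-; move: (m - k) => d; elim: d k ik => [|d IHd] k ik.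
  by rewrite rho_desc_refl; apply: commute1.
rewrite rho_descS; last by lia.
apply: commuteM; last exact: rho_far.
by rewrite addSnnS; apply: IHd; apply: ltnW.
Qed.

Lemma rho_desc_shift m k i : k < i -> i < m -> m < n ->
  rho_desc m k * rho_ i = rho_ i.-1 * rho_desc m k.
Proof.
case: i => // i; rewrite ltnS => /subnK <-; move: (i - k) => d.
elim: d k => [|d IHd] k im mn.
  rewrite add0n in im *.
  rewrite rho_descS; last exact: ltnW.
  rewrite rho_descS //.
  rewrite -!mulgA [rho_ k.+1 * (_ * rho_ k.+1)]mulgA -rho_braid; last by lia.
  by rewrite /= !mulgA rho_desc_far.
rewrite rho_descS; last by lia.
rewrite -mulgA rho_far; last by lia.
by rewrite mulgA addSnnS IHd ?mulgA //; lia.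
Qed.

(** Appending rho_i to rho_m ... rho_k lengthens it if i = k - 1 and shortens it if i = k. Otherwise
    the letter moves to the left end, unchanged if i < k - 1 and as rho_(i-1) if i > k, and joins
    w. *)
Lemma rho_word_coset m x : m.+1 < n -> rho_word m.+1 x ->
  exists w k, [/\ rho_word m w, k <= m.+1 & x = w * rho_desc m.+1 k].
Proof.
move=> mn; elim=> {x} [|x i _ [w [k [wP km ->]]] im].
  by exists 1, m.+1; split; rewrite ?rho_desc_refl ?mulg1 //; apply: rho_word1.
case: (ltngtP i k) => [ik|ki|eik].
- have [ik1|ki1] := eqVneq i.+1 k.
    exists w, i; split=> //; first exact: ltnW.
    by rewrite [rho_desc _ i]rho_descS // ik1 mulgA.
  exists (w * rho_ i), k; split=> //; first by apply: rho_wordM => //; lia.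
  by rewrite -!mulgA rho_desc_far //; lia.
- exists (w * rho_ i.-1), k; split=> //; first by apply: rho_wordM => //; lia.
  by rewrite -!mulgA rho_desc_shift.
- rewrite eik in im *; exists w, k.+1; split=> //.
  by rewrite (rho_descS im) -!mulgA rho_sq mulg1.
Qed.

Lemma mu_rho_ m (mn : m < n.-1) : mu (rho_ m) = adj_tperm (Ordinal mn).
Proof. by rewrite -[m]/(val (Ordinal mn)) rho_ord mu_rho. Qed.

Lemma mu_rho_desc m k (a : 'I_n) : k <= m -> a = m :> nat ->
  mu (rho_desc m k) a = k :> nat.
Proof.
move=> /subnK <-; move: (m - k) => d; elim: d k => [|d IHd] k am.
  by rewrite rho_desc_refl gmulf1 perm1.
have kn : k < n.-1 by have := ltn_ord a; lia.
rewrite rho_descS; last by lia.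
rewrite gmulfM /= permM (mu_rho_ kn) adj_tpermE addSnnS IHd /=; last by lia.
by rewrite eqxx; case: eqP => //; lia.
Qed.

Lemma mu_rho_word_fix m x (a : 'I_n) : m < n -> rho_word m x -> m < a ->
  mu x a = a.
Proof.
move=> mn xP ma; elim: xP => {x} [|x i _ IHx im]; first by rewrite gmulf1 perm1.
have i_n : i < n.-1 by lia.
rewrite gmulfM /= permM IHx (mu_rho_ i_n); apply: ord_inj.
by rewrite adj_tpermE /=; do ?case: eqP => //; lia.
Qed.

(* The point m is fixed by <rho_0, ..., rho_(m-2)> and is sent to k by        *)
(* rho_(m-1) ... rho_k, so only the trivial coset fixes it.                   *)
Lemma mu_rho_word_inj m x : m < n -> rho_word m x -> mu x = 1 -> x = 1.
Proof.
elim: m x => [|m IHm] x mn xP mux; first by case: xP.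
have [w [k [wP km eqx]]] := rho_word_coset mn xP.
have eqk : k = m.+1.
  (* Evaluate mu x = 1 at the point m+1: w fixes it and the coset representative sends it to k. *)
  have := mu_rho_desc km (erefl (Ordinal mn : nat)).
  have /(congr1 (fun p : 'S_n => p (Ordinal mn))) := mux.
  rewrite eqx gmulfM /= permM perm1 (mu_rho_word_fix _ wP) ?ltnSn //;
    last exact: ltnW.
  by move=> -> /= ->.
move: eqx; rewrite eqk rho_desc_refl mulg1 => eqx.
by apply: (IHm x); rewrite ?eqx // -?eqx; first exact: ltnW.
Qed.

Lemma GVB_rho_GH_decomp x :
  exists r a, rho_word n.-1 r /\ x = r * pres_to_GVB a.
Proof.
elim/GVB_ind: x => [|x i [r [a [rP ->]]]|x i [r [a [rP ->]]]].
- by exists 1, 1; split; [apply: rho_word1 | rewrite gmulf1 mulg1].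
- exists r, (a * pres_y (pt_lo i) (pt_hi i)); split=> //.
  rewrite gmulfM /= pres_to_GVB_y GVB_Y_lt //= GVB_y_base.
  by rewrite -[i : nat]/(val i) s_ord mulgA.
- exists (r * rho_ i), (pres_act (adj_tperm i) a); split.
    exact: rho_wordM.
  (* The image of A is normalised by rho_i, so rho_i passes to its left and joins r. *)
  by rewrite -pres_to_GVB_rho rho_ord -!mulgA -conjgC.
Qed.

Lemma mu_pres_to_GVB a : mu (pres_to_GVB a) = 1 :> 'S_n.
Proof. exact/eqP/(valP (pres_to_GH a)). Qed.

Lemma pres_to_GH_bij : 0 < n -> bijective (@pres_to_GH n).
Proof.
move=> n_gt0; exists (fun x => (sd_GVB (val x)).2) => [a|x].
  by rewrite -/(pres_to_GVB a) sd_pres_to_GVB.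
have [r [a [rP eqx]]] := GVB_rho_GH_decomp (val x).
have r1 : r = 1.
  apply: mu_rho_word_inj rP _; first by rewrite prednK.
  by have /eqP := valP x; rewrite /= eqx gmulfM /= mu_pres_to_GVB mulg1.
apply: val_inj; rewrite eqx r1 mul1g.
by rewrite -/(pres_to_GVB _) sd_pres_to_GVB.
Qed.

End RhoSubgroup.

Theorem theorem5p7 (n : nat) (hn : 0 < n) :
  is_presentation (@GH_rel n) (@GH_y n).
Proof.
exists (@pres_to_GH n); split; first exact: pres_to_GH_bij.
exact: pres_to_GH_gen.
Qed.
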